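(* For any group $G$, there exist a locally free acyclic group $A$ and a group homomorphism $\phi:A\rightarrow G$ such that every perfect subgroup of $G$ lies in the image of $\phi$.
   Context: A (discrete) group $A$ is acyclic if $H_n(A;\mathbb{Z})=0$ for all $n\geq 1$ (ordinary group homology with trivial integer coefficients). A group is locally free if every finitely generated subgroup of it is free. A group $P$ is perfect if $P=[P,P]$. *)

(* Defs.v *)
From HB Require Import structures.
From mathcomp Require Import all_boot all_order all_algebra.
From mathcomp Require Import boolp classical_sets functions cardinality.
From mathcomp Require Import freeg.

Set Implicit Arguments.
Unset Strict Implicit.
Unset Printing Implicit Defensive.

Import GRing.Theory.

Local Open Scope classical_set_scope.
Local Open Scope group_scope.

(* Arbitrary (possibly infinite) groups are [groupType]s; subsets and subgroups
   are Prop-valued, hence not required to be decidable. *)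

Record is_subgroup (G : groupType) (H : set G) : Prop := IsSubgroup {
  subgroup1 : H 1;
  subgroupM : forall x y, H x -> H y -> H (x * y);
  subgroupV : forall x, H x -> H x^-1 }.

Definition generated (G : groupType) (X : set G) : set G :=
  smallest (@is_subgroup G) X.

Definition commutator_subgroup (G : groupType) (P : set G) : set G :=
  generated [set [~ x, y] | x in P & y in P].

Definition perfect (G : groupType) (P : set G) : Prop :=
  P = commutator_subgroup P.

Definition finitely_generated (G : groupType) (H : set G) : Prop :=
  exists2 X : set G, finite_set X & H = generated X.

(* A group word is a sequence of letters (x, b), where (x, false) stands for x
   and (x, true) for x^-1. *)
Definition word_eval (G : groupType) (w : seq (G * bool)) : G :=
  \prod_(l <- w) (if l.2 then l.1^-1 else l.1).

Definition reduced_word (G : groupType) (w : seq (G * bool)) : bool :=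
  sorted (fun k l => ~~ ((k.1 == l.1) && (k.2 != l.2))) w.

(* Equality of letters is equality in G, so this forces 1 \notin S, and that S
   contains no x together with x^-1. *)
Definition free_basis (G : groupType) (H S : set G) : Prop :=
  S `<=` H /\
  forall x, H x -> exists! w : seq (G * bool),
    [/\ forall l, l \in w -> S l.1, reduced_word w & word_eval w = x].

Definition is_free (G : groupType) (H : set G) : Prop :=
  exists S : set G, free_basis H S.

Definition locally_free (G : groupType) : Prop :=
  forall H : set G, is_subgroup H -> finitely_generated H -> is_free H.

(* Group homology with trivial coefficients Z is computed by the inhomogeneous
   bar complex: C_n is the free abelian group on G^n, and the boundary map is
     d [g_1|...|g_(n+1)] = [g_2|...|g_(n+1)]
       + sum_(1 <= i <= n) (-1)^i [g_1|...|g_i g_(i+1)|...|g_(n+1)]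
       + (-1)^(n+1) [g_1|...|g_n]. *)
Notation bar_chain G n := {freeg (n.-tuple G) / int}.

(* Entries are indexed from 0: t`_j is g_(j+1). *)
Definition bar_face (G : groupType) (n : nat) (i : 'I_n.+2)
    (t : n.+1.-tuple G) : n.-tuple G :=
  [tuple if (j.+1 < i)%N then t`_j
         else if j.+1 == i then t`_j * t`_j.+1
         else t`_j.+1 | j < n].

Definition bar_boundary (G : groupType) (n : nat) :
    bar_chain G n.+1 -> bar_chain G n :=
  fglift (fun t => \sum_(i < n.+2) << (-1) ^+ i *g bar_face i t >>)%R.

(* H_n(G; Z) = 0 for all n >= 1: in each degree n.+1, the cycles are
   boundaries. *)
Definition acyclic (G : groupType) : Prop :=
  forall (n : nat) (z : bar_chain G n.+1),
    bar_boundary z = 0%R ->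
    exists c : bar_chain G n.+2, bar_boundary c = z.

(* Main.v *)
Require Import Defs.
From HB Require Import structures.
From mathcomp Require Import all_boot all_order all_algebra.
From mathcomp Require Import boolp classical_sets functions cardinality.
From mathcomp Require Import generic_quotient freeg.

Set Implicit Arguments.
Unset Strict Implicit.
Unset Printing Implicit Defensive.

(** Call an element of G good if it lies in some perfect subgroup.  A good g is
    a product of commutators of good elements, each of these is again such a
    product, and so on forever.  Unfolding g in this way gives an infinite tree
    of good elements; let N be the set of nodes of all these trees, F the free
    group on N, and s the endomorphism of F that sends a node to the product of
    commutators of its children.  Evaluating a node at its label gives a
    homomorphism F -> G that is invariant under s, so it extends to the direct
    limit A of F -s-> F -s-> F -s-> ..., and its image contains all good
    elements because every good element labels a root.

    The endomorphism s is injective: after killing all children but the first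
    two of each node, it sends distinct nodes to commutators of disjoint pairs
    of generators, and no cancellation occurs in such words ([comm_hom_inj],
    [subst_inj]).  Hence every finitely generated subgroup of A lies in one copy
    of F, and it is free by the Nielsen-Schreier theorem ([schreier_basis],
    [telescope_locally_free]).

    Homology commutes with the direct limit, so for acyclicity
    ([telescope_acyclic]) it is enough that F has no homology above degree one
    and that s is zero on the first homology.  The latter holds because the
    values of s are products of commutators ([subst_null_homologous]).  For the
    former, the augmentation ideal of the group ring of F is a free module, and
    Fox calculus turns this into an explicit contracting homotopy of the bar
    complex in degrees at least two ([contraction_homotopy], [fox_boundary],
    [fox_mul]). *)

Import GRing.Theory.

Local Open Scope classical_set_scope.
Local Open Scope group_scope.

Lemma morphM1 (F G : groupType) (f : F -> G) :
  {morph f : x y / x * y} -> f 1 = 1.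
Proof. by move=> fM; apply: (mulgI (f 1)); rewrite -fM !mulg1. Qed.

Lemma morphMV (F G : groupType) (f : F -> G) :
  {morph f : x y / x * y} -> {morph f : x / x^-1}.
Proof. by move=> fM x; apply: (mulgI (f x)); rewrite -fM !mulgV morphM1. Qed.

(** * Free groups as groups of reduced words *)

Section Words.
Variable X : choiceType.
Implicit Types (l m : X * bool) (w : seq (X * bool)).

Definition flip l := (l.1, ~~ l.2).

Lemma flipK : involutive flip.
Proof. by case=> x b; rewrite /flip /= negbK. Qed.

Definition uncancelled l m := ~~ ((l.1 == m.1) && (l.2 != m.2)).

Lemma uncancelledE l m : uncancelled l m = (m != flip l).
Proof.
case: l m => x b [y c]; rewrite /uncancelled /flip xpair_eqE /= eq_sym.
by case: b c => [] [].
Qed.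

Definition is_reduced w := sorted uncancelled w.

(** Left multiplication by a letter, on reduced words. *)
Definition push l w :=
  if w is m :: w' then if m == flip l then w' else l :: w else [:: l].

Definition inverse_word w := rev (map flip w).

Lemma inverse_wordK : involutive inverse_word.
Proof. by move=> w; rewrite /inverse_word map_rev revK (mapK flipK). Qed.

Lemma push_reduced l w : is_reduced w -> is_reduced (push l w).
Proof.
case: w => [|m w] //= rw; case: ifPn => [_|nml]; first exact: path_sorted rw.
by rewrite /is_reduced /= uncancelledE nml.
Qed.

Lemma push_path l w : is_reduced (l :: w) -> push l w = l :: w.
Proof.
by case: w => [|m w] //; rewrite /is_reduced /= uncancelledE => /andP[/negPf->].
Qed.

Lemma pushK l w : is_reduced w -> push l (push (flip l) w) = w.
Proof.
case: w => [_|m w] /=; first by rewrite eqxx.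
rewrite flipK; case: eqP => [->|_ _]; first exact: push_path.
by rewrite /= eqxx.
Qed.

Lemma inverse_word_reduced w : is_reduced w -> is_reduced (inverse_word w).
Proof.
rewrite /is_reduced /inverse_word rev_sorted sorted_map; apply: sub_sorted.
move=> l m; rewrite /relpre /= !uncancelledE; apply: contra.
by rewrite flipK => /eqP->.
Qed.

(** Letters acting by mutually inverse maps make a word act only through its
    reduction; multiplication, evaluation, the reading of Schreier generators
    and Fox calculus all arise this way. *)
Section Action.
Variables (T : Type) (act : X * bool -> T -> T).
Hypothesis actK : forall l t, act l (act (flip l) t) = t.

Lemma foldr_push l w t : foldr act t (push l w) = act l (foldr act t w).
Proof.
case: w => [|m w] //=; case: eqP => // ->.
by rewrite actK.
Qed.

Lemma foldr_foldr_push u v t :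
  foldr act t (foldr push v u) = foldr act (foldr act t v) u.
Proof. by elim: u => //= l u <-; rewrite foldr_push. Qed.

Lemma foldr_inverse_word w t :
  foldr act (foldr act t w) (inverse_word w) = t.
Proof.
elim: w t => [|l w IHw] t //=.
have actKV t' : act (flip l) (act l t') = t' by rewrite -{2}(flipK l) actK.
by rewrite /inverse_word /= rev_cons foldr_rcons actKV; apply: IHw.
Qed.

End Action.

Lemma foldr_push_cat w1 w2 :
  is_reduced (w1 ++ w2) -> foldr push w2 w1 = w1 ++ w2.
Proof.
elim: w1 => //= l w1 IHw1 rw; rewrite IHw1; first exact: push_path.
exact: path_sorted rw.
Qed.

Lemma mem_foldr_push u v l :
  l \in foldr push v u -> (l \in u) || (l \in v).
Proof.
elim: u => //= m u IHu.
case: (foldr push v u) IHu => [|k w] IHu /=.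
  by rewrite !inE => ->.
case: ifP => _.
  by move=> lw; rewrite inE -orbA IHu ?orbT // inE lw orbT.
by rewrite inE => /predU1P[->|/IHu]; rewrite inE ?eqxx // -orbA => ->; rewrite orbT.
Qed.

Record free_group :=
  FreeGroup { word : seq (X * bool); word_reduced : is_reduced word }.

HB.instance Definition _ := [isSub for word].
HB.instance Definition _ := [Choice of free_group by <:].

Definition push_free l (u : free_group) : free_group :=
  FreeGroup (push_reduced l (word_reduced u)).

Lemma push_freeK l u : push_free l (push_free (flip l) u) = u.
Proof. by apply: val_inj; rewrite /= pushK // word_reduced. Qed.

Definition free_one : free_group := @FreeGroup [::] isT.
Definition free_inv (u : free_group) : free_group :=
  FreeGroup (inverse_word_reduced (word_reduced u)).
Definition free_mul (u v : free_group) : free_group :=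
  foldr push_free v (word u).

Lemma word_free_mul u v : word (free_mul u v) = foldr push (word v) (word u).
Proof. by rewrite /free_mul; elim: (word u) => //= l w ->. Qed.

Lemma free_mulA : associative free_mul.
Proof.
move=> u v w.
by rewrite [RHS]/free_mul word_free_mul (foldr_foldr_push push_freeK).
Qed.

Lemma free_mul1g : left_id free_one free_mul. Proof. by []. Qed.

Lemma free_mulg1 : right_id free_one free_mul.
Proof.
move=> u; apply: val_inj; rewrite /= word_free_mul.
by rewrite foldr_push_cat cats0 ?word_reduced.
Qed.

Lemma free_mulVg : left_inverse free_one free_inv free_mul.
Proof.
move=> u; rewrite -[X in free_mul _ X]free_mulg1.
exact: (foldr_inverse_word push_freeK).
Qed.

Lemma free_mulgV : right_inverse free_one free_inv free_mul.
Proof.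
move=> u; have := free_mulVg (free_inv u); congr (free_mul _ _ = _).
by apply: val_inj; rewrite /= inverse_wordK.
Qed.

HB.instance Definition _ := isGroup.Build free_group
  free_mulA free_mul1g free_mulg1 free_mulVg free_mulgV.

Lemma wordM (u v : free_group) : word (u * v) = foldr push (word v) (word u).
Proof. exact: word_free_mul. Qed.

Lemma wordV (u : free_group) : word u^-1 = inverse_word (word u).
Proof. by []. Qed.

Definition letter l : free_group := @FreeGroup [:: l] isT.
Definition gen (x : X) : free_group := letter (x, false).

Lemma letter_flip l : letter (flip l) = (letter l)^-1.
Proof. exact: val_inj. Qed.

(** Multiplying by a generator or its inverse on the left is a step of the
    word recursion, so properties of all elements reduce to one letter at a
    time. *)
Lemma free_group_ind (P : free_group -> Prop) :
  P 1 -> (forall l u, P u -> P (letter l * u)) -> forall u, P u.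
Proof.
move=> P1 PM [w]; elim: w => [|l w IHw] rw; first by congr P: P1; apply: val_inj.
have rw' : is_reduced w by exact: path_sorted rw.
suff -> : FreeGroup rw = letter l * FreeGroup rw' by apply/PM/IHw.
by apply: val_inj; rewrite [RHS](wordM (letter l)) /= push_path.
Qed.

Section Universal.
Variables (G : groupType) (f : X -> G).

Definition letter_val l : G := if l.2 then (f l.1)^-1 else f l.1.

Lemma letter_val_flip l : letter_val (flip l) = (letter_val l)^-1.
Proof. by case: l => x [] //=; rewrite /letter_val /= invgK. Qed.

Definition free_eval (u : free_group) : G :=
  foldr (fun l t => letter_val l * t) 1 (word u).

Lemma free_evalM : {morph free_eval : u v / u * v}.
Proof.
move=> u v; rewrite /free_eval wordM foldr_foldr_push => [|l t]; last first.
  by rewrite letter_val_flip mulVKg.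
elim: (word u) => [|l w IHw] /=; first by rewrite mul1g.
by rewrite IHw mulgA.
Qed.

HB.instance Definition _ := isMultiplicative.Build free_group G free_eval free_evalM.
HB.instance Definition _ :=
  Multiplicative_isUMagmaMorphism.Build free_group G free_eval (erefl _).

Lemma free_eval_letter l : free_eval (letter l) = letter_val l.
Proof. exact: mulg1. Qed.

Lemma free_eval_gen x : free_eval (gen x) = f x.
Proof. exact: free_eval_letter. Qed.

Lemma free_evalE u : free_eval u = \prod_(l <- word u) letter_val l.
Proof. by rewrite unlock. Qed.

End Universal.

End Words.

Lemma free_hom_eq (X : choiceType) (G : groupType)
    (f g : free_group X -> G) :
  {morph f : u v / u * v} -> {morph g : u v / u * v} ->
  (forall x, f (gen x) = g (gen x)) -> f =1 g.
Proof.
move=> fM gM fg.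
elim/free_group_ind => [|[x b] u IHu]; first by rewrite !morphM1.
rewrite fM gM IHu; congr (_ * _); case: b; last exact: fg.
by rewrite -[(x, true)]/(flip (x, false)) letter_flip !morphMV ?fg.
Qed.

(** * Subgroups and free bases *)

Section Subgroups.
Variable G : groupType.
Implicit Types (H K S : set G).

Lemma generated_subgroup S : is_subgroup (generated S).
Proof.
split=> [K [[]]//|x y Sx Sy K KS|x Sx K KS]; move: (KS) => [[K1 KM KV] _].
  by apply: KM; [apply: Sx | apply: Sy].
by apply: KV; apply: Sx.
Qed.

Lemma generated_sub S K : is_subgroup K -> S `<=` K -> generated S `<=` K.
Proof. by move=> sK SK; apply: smallest_sub. Qed.

Lemma sub_generated S : S `<=` generated S.
Proof. by move=> x Sx K [_]; apply. Qed.

Lemma generated_word S x : generated S x ->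
  exists2 u : free_group G,
    forall l, l \in word u -> S l.1 & free_eval idfun u = x.
Proof.
pose K := [set y | exists2 u : free_group G,
                     forall l, l \in word u -> S l.1 & free_eval idfun u = y].
apply: (@generated_sub S K) => [|y Sy]; last first.
  by exists (gen y); rewrite ?free_eval_gen // => l /[!inE] /eqP->.
split.
- by exists 1; rewrite ?gmulf1.
- move=> _ _ [u uS <-] [v vS <-]; exists (u * v); rewrite ?gmulfM // => l.
  by rewrite wordM => /mem_foldr_push/orP[/uS|/vS].
- move=> _ [u uS <-]; exists u^-1; rewrite ?gmulfV // => l.
  by rewrite wordV mem_rev => /mapP[m /uS mS ->].
Qed.

(** A generating set is a basis as soon as some homomorphism to the free group
    on its elements sends each of them to the corresponding generator: that
    homomorphism reads off a reduced word from its value. *)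
Lemma free_basis_of_hom H S (theta : G -> free_group G) :
    is_subgroup H -> S `<=` H -> H `<=` generated S ->
    (forall a b, H a -> H b -> theta (a * b) = theta a * theta b) ->
    (forall s, S s -> theta s = gen s) ->
  free_basis H S.
Proof.
move=> [H1 HM HV] SH HS thetaM theta_gen.
split=> // x /HS /generated_word[u uS <-].
have theta1 : theta 1 = 1 by apply: (mulgI (theta 1)); rewrite -thetaM // !mulg1.
have thetaV a : H a -> theta a^-1 = (theta a)^-1.
  by move=> Ha; apply: (mulgI (theta a)); rewrite -thetaM ?mulgV //; apply: HV.
have evalH w : (forall l, l \in w -> S l.1) -> H (word_eval w).
  rewrite /word_eval; elim: w => [|l w IHw] wS; first by rewrite big_nil.
  rewrite big_cons; apply: HM; last by apply: IHw => m mw; apply: wS; rewrite inE mw orbT.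
  by have /SH := wS l (mem_head _ _); case: l.2 => // /HV.
have theta_eval w : (forall l, l \in w -> S l.1) -> is_reduced w ->
    word (theta (word_eval w)) = w.
  elim: w => [|l w IHw] wS rw; first by rewrite /word_eval big_nil theta1.
  have Sl : S l.1 by apply: wS; rewrite mem_head.
  have wS' m : m \in w -> S m.1 by move=> mw; apply: wS; rewrite inE mw orbT.
  have Hl : H (if l.2 then l.1^-1 else l.1) by case: l.2; [apply/HV/SH|apply: SH].
  rewrite {1}/word_eval big_cons thetaM //; last exact: evalH.
  have -> : theta (if l.2 then l.1^-1 else l.1) = letter l.
    case: l Sl {wS rw Hl} => [s []] /= Ss; last exact: theta_gen.
    by rewrite thetaV ?theta_gen -?letter_flip //; exact: SH.
  rewrite wordM -[\prod_(_ <- _) _]/(word_eval w) IHw //; first exact: push_path.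
  exact: path_sorted rw.
exists (word u); split.
  by split=> //; [exact: word_reduced | rewrite free_evalE].
move=> w [wS rw wu]; rewrite -(theta_eval w) // wu free_evalE.
by rewrite -[\prod_(_ <- _) _]/(word_eval _) theta_eval ?word_reduced.
Qed.

End Subgroups.

(** * Subgroups of free groups are free *)

Section NielsenSchreier.
Variables (X : choiceType) (H : set (free_group X)).
Local Notation F := (free_group X).
Hypothesis sH : is_subgroup H.
Implicit Types (g h u v : F) (l : X * bool).

Let H1 : H 1. Proof. by case: sH. Qed.
Let HM h1 h2 : H h1 -> H h2 -> H (h1 * h2). Proof. by case: sH => _ + _; apply. Qed.
Let HV h : H h -> H h^-1. Proof. by case: sH => _ _; apply. Qed.

Lemma coset_dist_ex g : exists n, `[< exists2 h, H h & size (word (g * h)) = n >].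
Proof. by exists (size (word (g * 1))); apply/asboolP; exists 1. Qed.

(** The coset graph has the left cosets of H as vertices and an edge labelled x
    from [g H] to [x g H]; this is the distance of [g H] from the base point. *)
Definition coset_dist g := ex_minn (coset_dist_ex g).

Lemma coset_dist_le g h : H h -> (coset_dist g <= size (word (g * h)%g))%N.
Proof.
move=> Hh; rewrite /coset_dist; case: ex_minnP => n _; apply.
by apply/asboolP; exists h.
Qed.

Lemma coset_dist_rep g : exists2 h, H h & size (word (g * h)) = coset_dist g.
Proof. by rewrite /coset_dist; case: ex_minnP => n /asboolP. Qed.

Lemma coset_distH g h : H h -> coset_dist (g * h) = coset_dist g.
Proof.
have le g' h' : H h' -> (coset_dist (g' * h')%g <= coset_dist g')%N.
  move=> Hh'; have [k Hk <-] := coset_dist_rep g'.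
  have -> : g' * k = (g' * h') * (h'^-1 * k) by rewrite mulgA mulgK.
  by apply/coset_dist_le/HM => //; apply: HV.
move=> Hh; apply/eqP; rewrite eqn_leq le //=.
by rewrite -{1}(mulgK h g) le //; apply: HV.
Qed.

Definition descends g l := (coset_dist (letter (flip l) * g)%g < coset_dist g)%N.

Lemma descends_ex g : (0 < coset_dist g)%N -> exists l, descends g l.
Proof.
rewrite /descends; have [h Hh <-] := coset_dist_rep g.
case def_w: (word (g * h)) => [|l w] // _; exists l.
apply: leq_ltn_trans (coset_dist_le _ Hh) _; rewrite -mulgA wordM def_w /=.
by rewrite flipK eqxx.
Qed.

(** Since [xchoose] depends only on the extent of its predicate, the step chosen
    at g depends only on the coset of g, which makes representatives constant on
    cosets. *)
Definition via_step (P : pred (X * bool)) (next : X * bool -> F) : F :=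
  if pselect (exists l, P l) is left exP then
    let l := xchoose exP in letter l * next l
  else 1.

Fixpoint transversal_rec n g : F :=
  if n is n'.+1 then
    via_step (descends g) (fun l => transversal_rec n' (letter (flip l) * g))
  else 1.

(** A Schreier transversal: following one chosen geodesic step at each coset
    yields representatives whose paths form a spanning tree. *)
Definition transversal g := transversal_rec (coset_dist g) g.

Lemma transversal_recH n g h :
  H h -> transversal_rec n (g * h) = transversal_rec n g.
Proof.
move=> Hh; elim: n g => //= n IHn g; congr via_step; apply: funext => l.
  by rewrite /descends mulgA !(coset_distH _ Hh).
by rewrite mulgA IHn.
Qed.

Lemma transversalH g h : H h -> transversal (g * h) = transversal g.
Proof. by move=> Hh; rewrite /transversal coset_distH ?transversal_recH. Qed.

Lemma via_stepP (P : pred (X * bool)) next : (exists l, P l) ->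
  exists2 l, P l & via_step P next = letter l * next l.
Proof.
rewrite /via_step; case: pselect => // exP _; exists (xchoose exP) => //.
exact: xchooseP.
Qed.

Lemma via_step0 (P : pred (X * bool)) next : (forall l, ~~ P l) -> via_step P next = 1.
Proof. by rewrite /via_step; case: pselect => // -[l Pl] /(_ l); rewrite Pl. Qed.

(** The distance decreases at each step, so any fuel beyond it gives the same
    representative. *)
Lemma transversal_rec_stable n m g :
  (coset_dist g <= n)%N -> (coset_dist g <= m)%N ->
  transversal_rec n g = transversal_rec m g.
Proof.
elim: n m g => [|n IHn] [|m] g //=.
- by rewrite leqn0 => /eqP d0 _; rewrite via_step0 // => l; rewrite /descends d0.
- by rewrite leqn0 => _ /eqP d0; rewrite via_step0 // => l; rewrite /descends d0.
move=> gn gm; have [d0|d_gt0] := posnP (coset_dist g).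
  by rewrite !via_step0 // => l; rewrite /descends d0.
rewrite /via_step; case: pselect => // exP; congr (_ * _).
have := xchooseP exP; rewrite /descends => lt_d.
by apply: IHn; rewrite -ltnS; apply: leq_trans lt_d _.
Qed.

Lemma transversal_step g : (0 < coset_dist g)%N ->
  exists2 l, descends g l &
    transversal g = letter l * transversal (letter (flip l) * g).
Proof.
move=> d_gt0; case d_eq: (coset_dist g) (d_gt0) => [|n] // _.
rewrite {1}/transversal d_eq /=; set next := fun l => transversal_rec n _.
have [l gl ->] := via_stepP next (descends_ex d_gt0); exists l => //.
congr (_ * _); apply: transversal_rec_stable => //.
by rewrite -ltnS -d_eq.
Qed.

Lemma transversal0 g : coset_dist g = 0%N -> transversal g = 1.
Proof. by rewrite /transversal => ->. Qed.

Lemma transversal_ind (P : F -> Prop) :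
  (forall g, coset_dist g = 0%N -> P g) ->
  (forall g l, P (letter (flip l) * g) ->
     transversal g = letter l * transversal (letter (flip l) * g) -> P g) ->
  forall g, P g.
Proof.
move=> P0 PS g; have [n] := ubnP (coset_dist g); elim: n g => // n IHn g.
have [d0 _|d_gt0 gn] := posnP (coset_dist g); first exact: P0.
have [l gl tl] := transversal_step d_gt0; apply: PS tl; apply: IHn.
by apply: leq_trans gl _; rewrite -ltnS.
Qed.

Lemma transversal1 : transversal 1 = 1.
Proof.
apply: transversal0; apply/eqP; rewrite -leqn0.
by apply: leq_trans (coset_dist_le _ H1) _; rewrite mulg1.
Qed.

Lemma transversal_mem g : exists2 h, H h & transversal g = g * h.
Proof.
elim/transversal_ind: g => [g d0|g l [h Hh IHg] ->]; last first.
  by exists h; rewrite // IHg letter_flip -mulgA mulVKg.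
have [h Hh] := coset_dist_rep g; rewrite d0 => /size0nil gh.
by exists h; rewrite // transversal0 //; apply: val_inj.
Qed.

(** The loop at the base point that follows the tree to [g H], crosses the
    edge labelled [x], and returns along the tree. *)
Definition schreier g (x : X) : F :=
  (transversal (gen x * g))^-1 * (gen x * transversal g).

Definition schreier_set : set F :=
  [set s | s <> 1 /\ exists g x, s = schreier g x].

Lemma schreierH g h x : H h -> schreier (g * h) x = schreier g x.
Proof. by move=> Hh; rewrite /schreier [gen x * (g * h)]mulgA !(transversalH _ Hh). Qed.

Lemma schreier_mem g x : H (schreier g x).
Proof.
rewrite /schreier; have [h Hh ->] := transversal_mem g.
have [k Hk ->] := transversal_mem (gen x * g).
by rewrite invgM -mulgA [gen x * (g * h)]mulgA mulKg; apply: HM => //; apply: HV.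
Qed.

Lemma schreier_generated g x : generated schreier_set (schreier g x).
Proof.
have [->|/eqP s1] := eqVneq (schreier g x) 1.
  by have [] := generated_subgroup schreier_set.
by apply: sub_generated; split=> //; exists g, x.
Qed.

(** Along the path of u from any vertex, the product of the Schreier loops
    telescopes; for u in H and the base vertex only u is left. *)
Lemma schreier_set_generates : H `<=` generated schreier_set.
Proof.
move=> h Hh; have [gen1 genM genV] := generated_subgroup schreier_set.
suff gen_path u g :
    generated schreier_set ((transversal (u * g))^-1 * (u * transversal g)).
  have := gen_path h 1; rewrite mulg1 -[h in transversal h]mul1g transversalH //.
  by rewrite transversal1 invg1 mul1g mulg1.
elim/free_group_ind: u => [|l u IHu].
  by rewrite !mul1g mulVg.
have -> : (transversal (letter l * u * g))^-1 * (letter l * u * transversal g) =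
    ((transversal (letter l * (u * g)))^-1 * (letter l * transversal (u * g))) *
    ((transversal (u * g))^-1 * (u * transversal g)).
  by rewrite -!mulgA mulVKg.
apply: genM IHu; move: (u * g) => g'.
case: l => x []; last exact: schreier_generated.
rewrite -[(x, true)]/(flip (x, false)) letter_flip.
have := genV _ (schreier_generated ((gen x)^-1 * g') x).
by rewrite /schreier mulVKg !invgM invgK -mulgA.
Qed.

(** The elements of F themselves serve as names for the Schreier generators;
    edges of the spanning tree give a trivial loop and get the trivial name. *)
Definition edge g x : free_group F :=
  if schreier g x == 1 then 1 else gen (schreier g x).

(** The wreath product argument for freeness: F acts on pairs made of a vertex
    and an element of the free group on names, where crossing an edge multiplies
    the second component by the name of the edge.  The second component depends
    only on the coset of the first ([runH]), so on H, which fixes the base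
    vertex, it is a homomorphism ([read]). *)
Definition cross l (p : F * free_group F) : F * free_group F :=
  (letter l * p.1,
   if l.2 then (edge (letter l * p.1) l.1)^-1 * p.2 else edge p.1 l.1 * p.2).

Lemma crossK l p : cross l (cross (flip l) p) = p.
Proof.
case: p => g k; rewrite /cross /= letter_flip mulVKg; case: l => x [] /=.
  by rewrite mulKg.
by rewrite mulVKg.
Qed.

Definition run u p := foldr cross p (word u).

Lemma runM u v p : run (u * v) p = run u (run v p).
Proof. by rewrite /run wordM (foldr_foldr_push crossK). Qed.

Lemma run1 u p : (run u p).1 = u * p.1.
Proof.
elim/free_group_ind: u => [|l u IHu]; first by rewrite mul1g.
by rewrite runM /= IHu mulgA.
Qed.

Lemma run2 u g k : (run u (g, k)).2 = (run u (g, 1)).2 * k.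
Proof.
elim/free_group_ind: u => [|l u IHu]; first by rewrite mul1g.
by rewrite !runM /= !run1 IHu /=; case: l.2; rewrite mulgA.
Qed.

Lemma edgeH g h x : H h -> edge (g * h) x = edge g x.
Proof. by move=> Hh; rewrite /edge schreierH. Qed.

Lemma runH u g h k : H h -> (run u (g * h, k)).2 = (run u (g, k)).2.
Proof.
move=> Hh; elim/free_group_ind: u => [|l u IHu] //.
by rewrite !runM /= !run1 /= IHu !mulgA !(edgeH _ _ Hh).
Qed.

(** The path of a representative stays in the spanning tree, all of whose edges
    have the trivial name. *)
Lemma run_transversal g : run (transversal g) (1, 1) = (transversal g, 1).
Proof.
elim/transversal_ind: g => [g d0|g l IHg tg]; first by rewrite transversal0.
rewrite tg runM IHg /run /cross /=; congr (_, _).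
have [h Hh th] := transversal_mem (letter (flip l) * g).
case: l tg th {IHg} => x [] /= tg th.
  rewrite {1}th -[(x, true)]/(flip (x, false)).
  have -> : letter (flip (x, false)) * (letter (flip (flip (x, false))) * g * h) = g * h.
    by rewrite flipK letter_flip mulgA mulKg.
  rewrite edgeH // /edge /schreier ifT ?invg1 ?mulg1 //.
  rewrite tg -[(x, true)]/(flip (x, false)) letter_flip mulVKg /flip /=.
  by rewrite mulVg.
rewrite {1}th edgeH // /edge /schreier ifT ?mulg1 //.
by rewrite letter_flip mulVKg tg letter_flip mulVg.
Qed.

Definition read u : free_group F := (run u (1, 1)).2.

Lemma readM a b : H a -> H b -> read (a * b) = read a * read b.
Proof.
move=> Ha Hb; rewrite /read runM [run b _]surjective_pairing run1 run2 mulg1.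
by rewrite -[b in run a (b, _)]mul1g runH.
Qed.

(** The loop of a Schreier generator leaves the spanning tree exactly once. *)
Lemma read_schreier s : schreier_set s -> read s = gen s.
Proof.
move=> [s1 [g [x def_s]]].
rewrite def_s in s1 *; rewrite {1}/schreier /read runM.
set t := transversal (gen x * g).
have -> : run (gen x * transversal g) (1, 1) =
    (gen x * transversal g, gen (schreier g x)).
  rewrite runM run_transversal /run /cross /= mulg1; congr (_, _).
  have [h Hh ->] := transversal_mem g.
  by rewrite edgeH // /edge; case: eqP.
have [h Hh th] : exists2 h, H h & gen x * transversal g = t * h.
  by exists (schreier g x); [exact: schreier_mem | rewrite /schreier mulVKg].
rewrite th runH // run2.
by have /= := runM t^-1 t (1, 1); rewrite run_transversal mulVg => <-; rewrite mul1g.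
Qed.

Lemma schreier_basis : free_basis H schreier_set.
Proof.
apply: (free_basis_of_hom sH _ schreier_set_generates readM read_schreier).
by move=> _ [_ [g [x ->]]]; exact: schreier_mem.
Qed.

End NielsenSchreier.

Lemma free_basis_image (F G : groupType) (f : {multiplicative F -> G})
    (H S : set F) :
  injective f -> free_basis H S -> free_basis (f @` H) (f @` S).
Proof.
move=> f_inj [SH HS]; split=> [_ [s /SH Hs <-]|_ [x /HS[w [[wS rw wx] w_uniq]] <-]].
  by exists s.
pose fl (l : F * bool) := (f l.1, l.2).
have fl_inj : injective fl by move=> [x1 b1] [x2 b2] [/f_inj -> ->].
have eval_map v : word_eval (map fl v) = f (word_eval v).
  rewrite /word_eval; elim: v => [|l v IHv].
    by rewrite !big_nil (morphM1 (@gmulfM _ _ f)).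
  by rewrite !big_cons gmulfM IHv /=; case: l.2; rewrite ?(morphMV (@gmulfM _ _ f)).
have reduced_map v : reduced_word (map fl v) = reduced_word v.
  rewrite /reduced_word sorted_map; apply: eq_sorted => l m.
  by rewrite /relpre /= (inj_eq f_inj).
exists (map fl w); split; first split.
- by move=> _ /mapP[l /wS Sl ->]; exists l.1.
- by rewrite reduced_map.
- by rewrite eval_map wx.
move=> v [vS rv vx].
have [v' v'S def_v] : exists2 v', forall l, l \in v' -> S l.1 & v = map fl v'.
  elim: v vS {rv vx} => [|[y b] v IHv] vS; first by exists [::].
  have [s Ss sy] := vS _ (mem_head _ _).
  have [|v' v'S ->] := IHv; first by move=> l lv; apply: vS; rewrite inE lv orbT.
  exists ((s, b) :: v'); last by rewrite /= /fl /= sy.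
  by move=> l /[!inE] /predU1P[->|/v'S].
rewrite def_v; congr map; apply: w_uniq; split=> //.
  by rewrite -reduced_map -def_v.
by apply: f_inj; rewrite -eval_map -def_v.
Qed.

Lemma free_group_subgroup_free (X : choiceType) (H : set (free_group X)) :
  is_subgroup H -> is_free H.
Proof. by move=> sH; exists (schreier_set sH); exact: schreier_basis. Qed.

(** * Inverting an injective endomorphism *)

Section Telescope.
Variables (F : groupType) (s : {multiplicative F -> F}).
Hypothesis s_inj : injective s.
Implicit Types (u v w : F) (m n k : nat).

Lemma iterM n : {morph iter n s : u v / u * v}.
Proof. by elim: n => // n IHn u v; rewrite /= IHn gmulfM. Qed.

Lemma iter_s_inj n : injective (iter n s).
Proof. by elim: n => // n IHn u v /s_inj/IHn. Qed.

Lemma iterC m n u : iter m s (iter n s u) = iter n s (iter m s u).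
Proof. by rewrite -!iterD addnC. Qed.

(** A pair [(n, u)] stands for u in the n-th copy of F in the sequence
    F -s-> F -s-> ....  Elements of levels m and n are compared at level m + n,
    which suffices because s is injective. *)
Definition tele_eq (p q : nat * F) := iter q.1 s p.2 == iter p.1 s q.2.

Lemma tele_eq_refl : reflexive tele_eq. Proof. by move=> p; exact: eqxx. Qed.

Lemma tele_eq_sym : symmetric tele_eq. Proof. by move=> p q; exact: eq_sym. Qed.

Lemma tele_eq_trans : transitive tele_eq.
Proof.
move=> [m v] [n u] [k w] /eqP /= uv /eqP /= vw; apply/eqP/(@iter_s_inj m) => /=.
by rewrite iterC uv iterC vw iterC.
Qed.

Canonical tele_equiv := EquivRel tele_eq tele_eq_refl tele_eq_sym tele_eq_trans.

Definition telescope := {eq_quot tele_equiv}%qT.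

HB.instance Definition _ := Choice.on telescope.

Definition level n u : telescope := (\pi_({eq_quot tele_equiv}) (n, u))%qT.

Lemma levelP m n u v : level m u = level n v <-> iter n s u = iter m s v.
Proof. by split=> [/eqmodP/eqP//|uv]; apply/eqmodP/eqP. Qed.

Lemma level_inj n : injective (level n).
Proof. by move=> u v /levelP/iter_s_inj. Qed.

Lemma level_iter n k u : level n u = level (k + n) (iter k s u).
Proof. by apply/levelP; rewrite iterD iterC. Qed.

Lemma level_repr (x : telescope) : level (repr x).1 (repr x).2 = x.
Proof. by rewrite /level -surjective_pairing reprK. Qed.

Lemma level_common (x y : telescope) : exists n u v, x = level n u /\ y = level n v.
Proof.
rewrite -(level_repr x) -(level_repr y); case: (repr x) (repr y) => [m u] [n v] /=.
exists (n + m)%N, (iter n s u), (iter m s v).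
by rewrite {2}addnC -!level_iter.
Qed.

Lemma level_common3 (x y z : telescope) :
  exists n u v w, [/\ x = level n u, y = level n v & z = level n w].
Proof.
have [m [u [v [-> ->]]]] := level_common x y; rewrite -(level_repr z).
case: (repr z) => n w /=; exists (n + m)%N, (iter n s u), (iter n s v), (iter m s w).
by rewrite {3}addnC -!level_iter.
Qed.

Definition tele_one : telescope := level 0 1.
Definition tele_inv (x : telescope) : telescope :=
  level (repr x).1 (repr x).2^-1.
Definition tele_mul (x y : telescope) : telescope :=
  level ((repr x).1 + (repr y).1)
    (iter (repr y).1 s (repr x).2 * iter (repr x).1 s (repr y).2).

Lemma iter1 n : iter n s 1 = 1.
Proof. exact: morphM1 (iterM n). Qed.

Lemma iterV n u : iter n s u^-1 = (iter n s u)^-1.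
Proof. exact: morphMV (iterM n) u. Qed.

Lemma tele_mulE n u v : tele_mul (level n u) (level n v) = level n (u * v).
Proof.
have /levelP := level_repr (level n u); have /levelP := level_repr (level n v).
rewrite /tele_mul; case: (repr _) (repr _) => [q y] [p x] /= yv xu.
by apply/levelP; rewrite !iterM iterC xu (iterC n) yv !iterD -(iterC p).
Qed.

Lemma tele_invE n u : tele_inv (level n u) = level n u^-1.
Proof.
have /levelP := level_repr (level n u).
by rewrite /tele_inv => xu; apply/levelP; rewrite !iterV xu.
Qed.

Lemma tele_oneE n : tele_one = level n 1.
Proof. by apply/levelP; rewrite /= iter1. Qed.

Lemma tele_mulA : associative tele_mul.
Proof.
move=> x y z; have [n [u [v [w [-> -> ->]]]]] := level_common3 x y z.
by rewrite !tele_mulE mulgA.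
Qed.

Lemma tele_mul1g : left_id tele_one tele_mul.
Proof.
move=> x; rewrite -(level_repr x); move: (_.1) (_.2) => n u.
by rewrite (tele_oneE n) tele_mulE mul1g.
Qed.

Lemma tele_mulg1 : right_id tele_one tele_mul.
Proof.
move=> x; rewrite -(level_repr x); move: (_.1) (_.2) => n u.
by rewrite (tele_oneE n) tele_mulE mulg1.
Qed.

Lemma tele_mulVg : left_inverse tele_one tele_inv tele_mul.
Proof.
move=> x; rewrite -(level_repr x); move: (_.1) (_.2) => n u.
by rewrite tele_invE tele_mulE mulVg (tele_oneE n).
Qed.

Lemma tele_mulgV : right_inverse tele_one tele_inv tele_mul.
Proof.
move=> x; rewrite -(level_repr x); move: (_.1) (_.2) => n u.
by rewrite tele_invE tele_mulE mulgV (tele_oneE n).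
Qed.

HB.instance Definition _ := isGroup.Build telescope
  tele_mulA tele_mul1g tele_mulg1 tele_mulVg tele_mulgV.

Lemma levelM n : {morph level n : u v / u * v}.
Proof. by move=> u v; rewrite -tele_mulE. Qed.

HB.instance Definition _ n := isMultiplicative.Build F telescope (level n) (@levelM n).

Section Extension.
Variables (G : groupType) (f : {multiplicative F -> G}).
Hypothesis fs : forall u, f (s u) = f u.

Definition tele_map (x : telescope) : G := f (repr x).2.

Lemma tele_map_level n u : tele_map (level n u) = f u.
Proof.
have f_iter m v : f (iter m s v) = f v by elim: m => //= m; rewrite fs.
have /levelP := level_repr (level n u); rewrite /tele_map => /(congr1 f).
by rewrite !f_iter.
Qed.

Lemma tele_mapM : {morph tele_map : x y / x * y}.
Proof.
move=> x y; have [n [u [v [-> ->]]]] := level_common x y.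
by rewrite -levelM !tele_map_level gmulfM.
Qed.

HB.instance Definition _ := isMultiplicative.Build telescope G tele_map tele_mapM.

Definition tele_morphism : {multiplicative telescope -> G} := tele_map.

End Extension.

Lemma range_level_subgroup n : is_subgroup (range (level n)).
Proof.
split; first by exists 1 => //; rewrite -(tele_oneE n).
  by move=> _ _ [u _ <-] [v _ <-]; exists (u * v); rewrite // levelM.
by move=> _ [u _ <-]; exists u^-1; rewrite // -tele_invE.
Qed.

Lemma finitely_generated_level (H : set telescope) :
  finitely_generated H -> exists n, H `<=` range (level n).
Proof.
move=> [T /finite_seqP[t ->] ->].
suff [n tn] : exists n, [set` t] `<=` range (level n).
  by exists n; apply: generated_sub tn; exact: range_level_subgroup.
elim: t => [|x t [n tn]]; first by exists 0%N.
rewrite -(level_repr x); move: (_.1) (_.2) => m u; exists (n + m)%N => y /=.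
rewrite inE => /predU1P[->|/tn[v _ <-]].
  by exists (iter n s u); rewrite // -level_iter.
by exists (iter m s v); rewrite // addnC -level_iter.
Qed.

End Telescope.

(** A finitely generated subgroup lives at a single level, which is a copy of
    the free group. *)
Lemma telescope_locally_free (X : choiceType)
    (s : {multiplicative free_group X -> free_group X}) (s_inj : injective s) :
  locally_free (telescope s_inj).
Proof.
move=> H [H1 HM HV] /finitely_generated_level[n Hn].
pose K := level s_inj n @^-1` H.
have [S KS] : is_free K.
  apply: free_group_subgroup_free; split; rewrite /K /preimage /=.
  - by rewrite -(tele_oneE s_inj n).
  - by move=> u v Hu Hv; rewrite levelM; exact: HM.
  - by move=> u Hu; rewrite -(tele_invE s_inj n); exact: HV.
exists (level s_inj n @` S); have <- : level s_inj n @` K = H.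
  apply/seteqP; split=> [_ [u Ku <-] //|x Hx]; have [u _ ux] := Hn x Hx.
  by exists u; rewrite // /K /preimage /= ux.
by apply: free_basis_image KS; exact: level_inj.
Qed.

(** * Substituting products of commutators for generators *)

(** One commutator for each generator: no cancellation occurs between the
    images of successive letters of a reduced word, since the last letter of
    each image is inverse to the first letter of the next only if the letters
    themselves were inverse. *)
Section Commutators.
Variable X : choiceType.
Implicit Types (l m : X * bool) (w : seq (X * bool)).

Definition comm_hom : free_group X -> free_group (X * bool)%type :=
  free_eval (fun x => [~ gen (x, false), gen (x, true)]).

HB.instance Definition _ := UMagmaMorphism.on comm_hom.

(** With the convention [~ x, y] = x^-1 y^-1 x y, this is the image of a letter
    under [comm_hom]; in particular inverting l only exchanges the two
    generators. *)
Definition comm_word l : seq ((X * bool) * bool) :=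
  [:: (l, true); (flip l, true); (l, false); (flip l, false)].

Lemma comm_word_reduced w :
  is_reduced w -> is_reduced (flatten (map comm_word w)).
Proof.
elim: w => // l w IHw rw; have {IHw} := IHw (path_sorted rw).
have flip_neq : (flip l == l) = false by case: l {rw} => x []; rewrite xpair_eqE andbF.
rewrite /is_reduced /= in rw *.
rewrite /(uncancelled (l, true)) /(uncancelled (_, true)) /(uncancelled (l, _)) /=.
rewrite flip_neq !andbF /=.
case: w rw => [|m w] //= /andP[]; rewrite uncancelledE => ml _ ->.
by rewrite andbT /uncancelled /= eq_sym (negPf ml).
Qed.

Lemma word_comm_hom u : word (comm_hom u) = flatten (map comm_word (word u)).
Proof.
case: u => w /= rw; elim: w rw => // l w IHw rw.
have rw' : is_reduced w by exact: path_sorted rw.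
have -> : FreeGroup rw = letter l * FreeGroup rw'.
  by apply: val_inj; rewrite [RHS](wordM (letter l)) /= push_path.
have -> : comm_hom (letter l * FreeGroup rw') =
    comm_hom (letter l) * comm_hom (FreeGroup rw') by exact: gmulfM.
rewrite wordM IHw.
have -> : word (comm_hom (letter l)) = comm_word l.
  rewrite /comm_hom free_eval_letter /letter_val.
  case: l {rw} => x []; rewrite /fst /snd ?invgR /commg /conjg !wordM !wordV /=.
    by do 3 rewrite /flip /= ?xpair_eqE ?andbF /=.
  by do 3 rewrite /flip /= ?xpair_eqE ?andbF /=.
exact: (foldr_push_cat (comm_word_reduced rw)).
Qed.

Lemma comm_hom_inj : injective comm_hom.
Proof.
apply: gmulf_inj => u /(congr1 (@word _)); rewrite word_comm_hom => u1.
by apply: val_inj; move: u1 => /=; case: (word u).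
Qed.

End Commutators.

Section Substitution.
Variables (N : choiceType) (child : N -> nat -> bool -> N) (k : N -> nat).
Hypothesis child_inj : forall x i b y j c,
  child x i b = child y j c -> [/\ x = y, i = j & b = c].

Definition subst_val (x : N) : free_group N :=
  \prod_(i < (k x).+1) [~ gen (child x i false), gen (child x i true)].

Definition subst : free_group N -> free_group N := free_eval subst_val.

HB.instance Definition _ := UMagmaMorphism.on subst.

Lemma subst_gen x : subst (gen x) = subst_val x.
Proof. exact: free_eval_gen. Qed.

(** Killing all generators outside the first commutators reduces injectivity of
    [subst] to the case of a single commutator for each generator. *)
Definition first_child (y : N) : free_group (N * bool)%type :=
  if pselect (exists z : N * bool, child z.1 0 z.2 == y) is left ex
  then gen (xchoose ex) else 1.

Lemma first_childE x i b :
  first_child (child x i b) = if i == 0%N then gen (x, b) else 1.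
Proof.
rewrite /first_child; case: pselect => [ex|no_ex].
  by have := xchooseP ex; case: (xchoose ex) => z c /= /eqP/child_inj[-> <- ->].
by case: eqP => // i0; case: no_ex; exists (x, b); rewrite i0 /=.
Qed.

Lemma subst_inj : injective subst.
Proof.
have comm_subst : free_eval first_child \o subst =1 @comm_hom N.
  apply: free_hom_eq => [u v||x]; rewrite /comp; [by rewrite !gmulfM|exact: gmulfM|].
  have -> : free_eval first_child (subst (gen x)) = \prod_(i < (k x).+1)
      [~ first_child (child x i false), first_child (child x i true)].
    rewrite subst_gen [LHS]gmulf_prod; apply: eq_bigr => i _.
    by rewrite -!(free_eval_gen first_child); exact: gmulfR.
  rewrite big_ord_recl big1 => [|i _]; last by rewrite !first_childE /= comm1g.
  by rewrite mulg1 !first_childE [RHS]free_eval_gen.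
by move=> u v uv; apply: comm_hom_inj; rewrite -!comm_subst /= uv.
Qed.

End Substitution.

(** * Chains in the bar complex *)

Section FreegInt.
Variables (K : choiceType).

HB.instance Definition _ (M : lmodType int) (f : K -> M) :=
  GRing.isZmodMorphism.Build {freeg K / int} M (fglift f) (lift_is_additive f).

Lemma fglift1 (M : lmodType int) (f : K -> M) x : fglift f << x >> = f x.
Proof. by rewrite liftU scale1r. Qed.

Lemma freegU_scale (c : int) (x : K) : << c *g x >> = (<< x >> *~ c)%R :> {freeg K / int}.
Proof. by rewrite freegU_mulz intz. Qed.

Lemma freeg_ind_sub (P : {freeg K / int} -> Prop) :
  (forall x, P << x >>) -> (forall a b, P a -> P b -> P (a - b)%R) ->
  P 0%R -> forall z, P z.
Proof.
move=> PU PB P0.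
have PN a : P a -> P (- a)%R by rewrite -sub0r; exact: PB.
have PD a b : P a -> P b -> P (a + b)%R by move=> Pa Pb; rewrite -[b]opprK; apply/PB/PN.
have PMn x n : P (<< x >> *+ n)%R by elim: n => [|n IHn] //; rewrite mulrS; exact: PD.
apply: freeg_ind_dom0 => // c x z _ _ Pz; apply: PD => //; rewrite freegU_scale.
by case: c => n; [exact: PMn | exact/PN/PMn].
Qed.

End FreegInt.

Local Notation lift := fintype.lift.

Section BarFaces.
Variable G : groupType.
Implicit Types (x y : G) (n : nat).

Lemma nth_bar_face n (i : 'I_n.+2) (t : n.+1.-tuple G) j : (j < n)%N ->
  (bar_face i t)`_j = if (j.+1 < i)%N then t`_j
         else if j.+1 == i then t`_j * t`_j.+1 else t`_j.+1.
Proof. by move=> jn; rewrite -[j]/(val (Ordinal jn)) -tnth_nth tnth_mktuple. Qed.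

Lemma eq_tuple_nth n (t u : n.-tuple G) :
  (forall j, (j < n)%N -> t`_j = u`_j) -> t = u.
Proof. by move=> tu; apply: eq_from_tnth => j; rewrite !(tnth_nth 1) tu. Qed.

Lemma bar_face_0 n x (t : n.-tuple G) : bar_face ord0 [tuple of x :: t] = t.
Proof.
apply: eq_tuple_nth => j jn.
by rewrite nth_bar_face.
Qed.

Lemma bar_face_1 n x (t : n.+1.-tuple G) :
  bar_face (lift ord0 ord0) [tuple of x :: t] = [tuple of x * thead t :: behead t].
Proof.
apply: eq_tuple_nth => j jn.
rewrite nth_bar_face //= {2}(tuple_eta t); case: j {jn} => //=.
by rewrite (tuple_eta t).
Qed.

Lemma bar_face_SS n x (t : n.+1.-tuple G) (i : 'I_n.+1) :
  bar_face (lift ord0 (lift ord0 i)) [tuple of x :: t] =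
  [tuple of x :: bar_face (lift ord0 i) t].
Proof.
apply: eq_tuple_nth => -[|j] jn.
  by rewrite nth_bar_face //=.
by rewrite nth_bar_face // [RHS](@nth_bar_face n).
Qed.

Lemma bar_boundaryU n (t : n.+1.-tuple G) :
  bar_boundary << t >> = (\sum_(i < n.+2) << bar_face i t >> *~ (-1) ^+ i)%R.
Proof.
by rewrite /bar_boundary fglift1; apply: eq_bigr => i _; rewrite freegU_scale.
Qed.

HB.instance Definition _ n := GRing.isZmodMorphism.Build
  (bar_chain G n.+1) (bar_chain G n) (@bar_boundary G n) (lift_is_additive _).

(** Setting aside the face that drops the first entry leaves a sum that obeys a
    recursion on the first entry ([inner_faces_cons]), from which all boundaries
    below are computed. *)
Definition inner_faces n (t : n.+1.-tuple G) : bar_chain G n :=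
  (\sum_(i < n.+1) << bar_face (lift ord0 i) t >> *~ (-1) ^+ i)%R.

Lemma lift_signMz n m (i : 'I_n) (z : bar_chain G m) :
  (z *~ (-1) ^+ lift ord0 i = - (z *~ (-1) ^+ i))%R.
Proof. by rewrite /= /bump /= exprS mulN1r mulrNz. Qed.

Lemma bar_boundary_cons n x (t : n.-tuple G) :
  bar_boundary << [tuple of x :: t] >> =
  (<< t >> - inner_faces [tuple of x :: t])%R.
Proof.
rewrite bar_boundaryU big_ord_recl bar_face_0 expr0 mulr1z; congr (_ + _)%R.
by rewrite /inner_faces -sumrN; apply: eq_bigr => i _; rewrite lift_signMz.
Qed.

Lemma inner_faces_cons n x (t : n.+1.-tuple G) :
  inner_faces [tuple of x :: t] =
  (<< [tuple of (x * thead t)%g :: behead t] >> -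
   \sum_(i < n.+1) << [tuple of x :: bar_face (lift ord0 i) t] >> *~ (-1) ^+ i)%R.
Proof.
rewrite /inner_faces big_ord_recl bar_face_1 expr0 mulr1z; congr (_ + _)%R.
by rewrite -sumrN; apply: eq_bigr => i _; rewrite bar_face_SS lift_signMz.
Qed.

End BarFaces.

(** * Vanishing of the higher homology of free groups *)

Lemma homotopy_cancel (V : zmodType) (a b c d s : V) :
  (a - b + c - s + (d - (c + d - b - s)) = a)%R.
Proof.
rewrite (addrAC c) (addrAC (c - b)%R) opprD [(d + _)%R]addrC subrK.
have -> : (a - b + c - s = a + (c - b - s))%R by rewrite !addrA (addrAC a).
by rewrite addrK.
Qed.

Section Contraction.
(** The chain [g1|g2|...|gn] can be regarded as g1 - 1 tensor [g2|...|gn], where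
    g1 - 1 lies in the augmentation ideal I.  If I is a free module with basis
    the x - 1, one can write g1 - 1 as a sum of (x - 1) u and send the chain to
    the sum of the [x|u|g2|...|gn]: this contracts the complex with coefficients
    in I.  The map [T] encodes the choice of the pairs (x, u), up to sign. *)
Variables (G : groupType) (T : G -> {freeg (G * G)%type / int}).

Definition paste n (t : n.-tuple G) (p : (G * G)%type) : bar_chain G n.+2 :=
  << [tuple of p.1 :: p.2 :: t] >>.

Definition translate (h : G) (z : {freeg (G * G)%type / int}) :=
  fglift (fun p => << (p.1, p.2 * h) >> : {freeg (G * G)%type / int}) z.

Definition contraction n : bar_chain G n.+1 -> bar_chain G n.+2 :=
  fglift (fun t : n.+1.-tuple G => fglift (paste [tuple of behead t]) (T (thead t))).

HB.instance Definition _ n := GRing.isZmodMorphism.Build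
  (bar_chain G n.+1) (bar_chain G n.+2) (@contraction n) (lift_is_additive _).

(* The last term of [T_mul] arises because T g contains an additional pair
   (1, 1): the bar complex is not normalized, so chains whose first entry is 1
   have to be contracted as well. *)
Hypothesis T_boundary : forall g,
  (fglift (fun p => << p.2 >> - << (p.1 * p.2)%g >> : {freeg G / int}) (T g) =
   << g >> - << 1%g >>)%R.
Hypothesis T_mul : forall g h,
  (T (g * h)%g = translate h (T g) + T h - << (1%g, h) >>)%R.

Lemma contraction_cons n g (t : n.-tuple G) :
  contraction << [tuple of g :: t] >> = fglift (paste t) (T g).
Proof.
rewrite /contraction fglift1 theadE.
by congr (fglift (paste _) _); apply: val_inj.
Qed.

Definition prepend n (t : n.-tuple G) : {freeg G / int} -> bar_chain G n.+1 :=
  fglift (fun g => << [tuple of g :: t] >>).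

HB.instance Definition _ n t := GRing.isZmodMorphism.Build
  {freeg G / int} (bar_chain G n.+1) (@prepend n t) (lift_is_additive _).

Lemma boundary_paste n (t : n.+1.-tuple G) z :
  bar_boundary (fglift (paste t) z) =
  (prepend t (fglift (fun p => << p.2 >> - << (p.1 * p.2)%g >> : {freeg G / int}) z) +
   fglift (paste [tuple of behead t]) (translate (thead t) z) -
   \sum_(i < n.+1) fglift (paste (bar_face (lift ord0 i) t)) z *~ (-1) ^+ i)%R.
Proof.
elim/freeg_ind_sub: z => [p|a b IHa IHb|]; last 2 first.
- rewrite /translate !raddfB /= IHa IHb /translate.
  under [in RHS]eq_bigr => i _ do rewrite raddfB mulrzBl.
  rewrite sumrB !opprD !opprK.
  by rewrite addrACA; congr (_ + _)%R; rewrite addrACA.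
- rewrite /translate !raddf0 big1 => [|i _]; last by rewrite raddf0 mul0rz.
  by rewrite subr0 addr0.
have pasteE m (u : m.-tuple G) : fglift (paste u) << p >> = paste u p by exact: fglift1.
rewrite /translate pasteE !fglift1 raddfB /= /prepend !fglift1.
under [in RHS]eq_bigr => i _ do rewrite pasteE.
rewrite /paste bar_boundary_cons inner_faces_cons big_ord_recl bar_face_1.
rewrite expr0 mulr1z.
have -> : (\sum_(i < n.+1) << [tuple of p.1 :: bar_face (lift ord0 (lift ord0 i))
      [tuple of p.2 :: t]] >> *~ (-1) ^+ lift ord0 i)%R =
    (\sum_(i < n.+1) - (<< [tuple of p.1 :: [tuple of p.2 :: bar_face (lift ord0 i) t]] >>
       *~ (-1) ^+ i))%R :> bar_chain G n.+2.
  by apply: eq_bigr => i _; rewrite bar_face_SS lift_signMz.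
rewrite sumrN opprB [(_ - _ - _)%R]addrC !addrA.
by congr (_ - << _ >> + << _ >> - _)%R; apply: val_inj.
Qed.

(** The defining identities of [T] say that prefixing with [T] is a contracting
    homotopy in all degrees at least two. *)
Lemma contraction_homotopy n (z : bar_chain G n.+2) :
  (bar_boundary (contraction z) + contraction (bar_boundary z) = z)%R.
Proof.
elim/freeg_ind_sub: z => [t|a b IHa IHb|]; last 2 first.
- by rewrite !raddfB /= addrACA -opprD IHa IHb.
- by rewrite !raddf0 addr0.
have [g [u ->]] : exists g (u : n.+1.-tuple G), t = [tuple of g :: u].
  by exists (thead t), [tuple of behead t]; exact: tuple_eta.
pose P := fglift (paste [tuple of behead u]).
pose faces := (\sum_(i < n.+1)
  fglift (paste (bar_face (lift ord0 i) u)) (T g) *~ (-1) ^+ i)%R.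
have -> : contraction (bar_boundary << [tuple of g :: u] >>) =
    (P (T (thead u)) - (P (T (g * thead u)%g) - faces))%R.
  have contrB (a b : bar_chain G n.+1) :
    (contraction (a - b) = contraction a - contraction b)%R by exact: raddfB.
  rewrite bar_boundary_cons inner_faces_cons !contrB contraction_cons.
  congr (_ - (_ - _))%R; first by rewrite {1}(tuple_eta u) contraction_cons.
  rewrite [LHS]raddf_sum; apply: eq_bigr => i _.
  by rewrite [LHS]raddfMz -contraction_cons.
have -> : P (T (g * thead u)%g) =
    (P (translate (thead u) (T g)) + P (T (thead u)) - << [tuple of 1%g :: u] >>)%R.
  rewrite T_mul [LHS]raddfB [X in (X - _)%R]raddfD [X in (_ - X)%R]fglift1.
  congr (_ - << _ >>)%R; rewrite [in RHS](tuple_eta u); exact: val_inj.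
rewrite contraction_cons boundary_paste T_boundary.
have -> : prepend u (<< g >> - << 1%g >>)%R =
    (<< [tuple of g :: u] >> - << [tuple of 1%g :: u] >>)%R.
  by rewrite [LHS]raddfB; congr (_ - _)%R; exact: fglift1.
exact: homotopy_cancel.
Qed.

End Contraction.

Lemma higher_cycles_bound (G : groupType) (T : G -> {freeg (G * G)%type / int}) :
    (forall g, fglift (fun p => << p.2 >> - << (p.1 * p.2)%g >> : {freeg G / int}) (T g) =
      << g >> - << 1%g >>)%R ->
    (forall g h, T (g * h)%g = translate h (T g) + T h - << (1%g, h) >>)%R ->
  forall n (z : bar_chain G n.+2), bar_boundary z = 0%R ->
    exists c, bar_boundary c = z.
Proof.
move=> Tb TM n z dz; exists (contraction T z).
have := contraction_homotopy Tb TM z.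
by rewrite dz [contraction T 0%R](raddf0 (contraction T (n := n))) addr0.
Qed.

Section FoxDerivative.
Variable X : choiceType.
Local Notation F := (free_group X).
Local Notation chains2 := {freeg (F * F)%type / int}.

Definition fox_step (l : X * bool) (p : F * chains2) : F * chains2 :=
  let x := gen l.1 in
  (letter l * p.1,
   if l.2 then (p.2 + << (x, x^-1 * p.1)%g >>)%R else (p.2 - << (x, p.1) >>)%R).

Lemma fox_stepK l p : fox_step l (fox_step (flip l) p) = p.
Proof.
case: p => u z; rewrite /fox_step /= letter_flip mulVKg; case: l => x [] /=.
  rewrite -[(x, true)]/(flip (x, false)) letter_flip invgK mulKg.
  by rewrite subrK.
by rewrite addrK.
Qed.

(** Let d_x be the right-handed Fox derivatives, determined by the identity
    u - 1 = sum over the generators x of (x - 1) d_x u in the group ring.  Then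
    [fox u] is (1, 1) minus the sum of the x tensor d_x u. *)
Definition fox (u : F) : chains2 :=
  (foldr fox_step (1%g, << (1%g, 1%g) >>%R) (word u)).2.

Lemma fox_letter l u :
  fox (letter l * u) =
  (if l.2 then fox u + << (gen l.1, (gen l.1)^-1 * u)%g >>
   else fox u - << (gen l.1, u) >>)%R.
Proof.
have run1 v : (foldr fox_step (1%g, << (1%g, 1%g) >>%R) (word v)).1 = v.
  elim/free_group_ind: v => // m v IHv.
  by rewrite wordM (foldr_foldr_push fox_stepK) /= IHv.
by rewrite {1}/fox wordM (foldr_foldr_push fox_stepK) /= run1.
Qed.

Lemma fox_boundary u :
  (fglift (fun p => << p.2 >> - << (p.1 * p.2)%g >> : {freeg F / int}) (fox u) =
   << u >> - << 1%g >>)%R.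
Proof.
elim/free_group_ind: u => [|[x b] u IHu]; first by rewrite [LHS]fglift1 mul1g.
rewrite fox_letter; case: b => /=.
  rewrite [LHS]raddfD [X in (X + _)%R]IHu [X in (_ + X)%R]fglift1 /= mulVKg.
  by rewrite -[(x, true)]/(flip (x, false)) letter_flip addrC addrA subrK.
rewrite [LHS]raddfB [X in (X - _)%R]IHu [X in (_ - X)%R]fglift1 /=.
by rewrite opprB addrC addrA subrK.
Qed.

Lemma fox_mul u v :
  (fox (u * v)%g = translate v (fox u) + fox v - << (1%g, v) >>)%R.
Proof.
elim/free_group_ind: u => [|[x b] u IHu].
  by rewrite mul1g /translate [fglift _ _]fglift1 /= mul1g addrAC subrr add0r.
rewrite -mulgA !fox_letter IHu /translate; case: b => /=.
  rewrite [fglift _ (_ + _)%R]raddfD [X in (_ + X + _ - _)%R]fglift1 /= mulgA.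
  by rewrite -!addrA; congr (_ + _)%R; rewrite [RHS]addrC -addrA.
rewrite [fglift _ (_ - _)%R]raddfB [X in (_ - X + _ - _)%R]fglift1 /=.
by rewrite -!addrA; congr (_ + _)%R; rewrite [RHS]addrC -addrA.
Qed.

End FoxDerivative.

(** * First homology and commutators *)

Section FirstHomology.
Variable G : groupType.
Implicit Types g h : G.

(** All 1-chains are cycles, so these are the elements with trivial class in the
    first homology, which is the abelianization. *)
Definition null_homologous : set G :=
  [set g | exists c, bar_boundary c = << [tuple g] >>].

Lemma bar_boundary2 g h :
  bar_boundary << [tuple g; h] >> =
  (<< [tuple h] >> - << [tuple (g * h)%g] >> + << [tuple g] >>)%R.
Proof.
have -> : [tuple g; h] = [tuple of g :: [tuple of h :: [tuple]]] by exact: val_inj.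
rewrite bar_boundary_cons inner_faces_cons big_ord_recl big_ord0 addr0 expr0 mulr1z.
rewrite opprB [(<< [tuple of g :: _] >> - _)%R]addrC addrA.
by congr (<< _ >> - << _ >> + << _ >>)%R; apply: eq_tuple_nth => -[].
Qed.

Lemma bar_boundaryD n (a b : bar_chain G n.+1) :
  bar_boundary (a + b)%R = (bar_boundary a + bar_boundary b)%R.
Proof. exact: raddfD. Qed.

Lemma bar_boundaryB n (a b : bar_chain G n.+1) :
  bar_boundary (a - b)%R = (bar_boundary a - bar_boundary b)%R.
Proof. exact: raddfB. Qed.

Lemma null_homologous_subgroup : is_subgroup null_homologous.
Proof.
have one : null_homologous 1.
  by exists << [tuple 1; 1] >>; rewrite bar_boundary2 mulg1 subrr add0r.
split=> //.
- move=> g h [c dc] [d dd]; exists (c + d - << [tuple g; h] >>)%R.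
  rewrite bar_boundaryB bar_boundaryD dc dd bar_boundary2.
  by rewrite opprD opprB addrC addrA subrK subrK.
- move=> g [c dc]; have [e de] := one.
  exists (<< [tuple g^-1%g; g] >> + e - c)%R.
  rewrite bar_boundaryB bar_boundaryD dc de bar_boundary2 mulVg.
  by rewrite (addrAC (_ - _)%R) subrK addrAC subrr add0r.
Qed.

Lemma commg_null_homologous g h : null_homologous [~ g, h].
Proof.
exists (<< [tuple (h * g)%g; [~ g, h]%g] >> - << [tuple g; h] >> + << [tuple h; g] >>)%R.
rewrite bar_boundaryD bar_boundaryB !bar_boundary2 -commgC.
by rewrite opprD opprB !addrA subrK addrAC subrK addrAC addrK subrK.
Qed.

End FirstHomology.

(** * Functoriality of the bar complex *)

Section ChainMap.
Variables (F G : groupType) (f : F -> G).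

Definition chain_map n : bar_chain F n -> bar_chain G n :=
  fglift (fun t : n.-tuple F => << [tuple of map f t] >>).

HB.instance Definition _ n := GRing.isZmodMorphism.Build
  (bar_chain F n) (bar_chain G n) (@chain_map n) (lift_is_additive _).

Lemma chain_mapU n (t : n.-tuple F) :
  chain_map << t >> = << [tuple of map f t] >>.
Proof. exact: fglift1. Qed.

Hypothesis fM : {morph f : x y / x * y}.

Lemma map_bar_face n (i : 'I_n.+2) (t : n.+1.-tuple F) :
  [tuple of map f (bar_face i t)] = bar_face i [tuple of map f t].
Proof.
apply: eq_tuple_nth => j jn.
rewrite (nth_map 1) ?size_tuple // !nth_bar_face //.
have nth_f k : (k < n.+1)%N -> [tuple of map f t]`_k = f t`_k.
  by move=> kn; rewrite (nth_map 1) ?size_tuple.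
rewrite !nth_f //; last by rewrite ltnW.
by case: ifP => // _; case: ifP.
Qed.

Lemma chain_map_boundary n (z : bar_chain F n.+1) :
  chain_map (bar_boundary z) = bar_boundary (chain_map z).
Proof.
elim/freeg_ind_sub: z => [t|a b IHa IHb|]; last 2 first.
- by rewrite !raddfB /= IHa IHb.
- by rewrite !raddf0.
rewrite chain_mapU !bar_boundaryU [LHS]raddf_sum; apply: eq_bigr => i _.
by rewrite [LHS]raddfMz [X in (X *~ _)%R]chain_mapU map_bar_face.
Qed.

End ChainMap.

Lemma chain_map_comp (F G H : groupType) (f : F -> G) (g : G -> H) n
    (z : bar_chain F n) :
  chain_map g (chain_map f z) = chain_map (g \o f) z.
Proof.
elim/freeg_ind_sub: z => [t|a b IHa IHb|]; last 2 first.
- by rewrite !raddfB /= IHa IHb.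
- by rewrite !raddf0.
by rewrite !chain_mapU; congr << _ >>; apply: val_inj; rewrite /= map_comp.
Qed.

Lemma chain_map_id (F : groupType) n (z : bar_chain F n) : chain_map id z = z.
Proof.
elim/freeg_ind_sub: z => [t|a b IHa IHb|]; last 2 first.
- by rewrite !raddfB /= IHa IHb.
- by rewrite !raddf0.
by rewrite chain_mapU; congr << _ >>; apply: val_inj; rewrite /= map_id.
Qed.

(** An injective map has a retraction, as a map of sets, and [chain_map] is
    functorial in maps of sets. *)
Lemma chain_map_inj (F G : groupType) (f : F -> G) n :
  injective f -> injective (@chain_map F G f n).
Proof.
move=> f_inj.
pose g y := if pselect (exists x, f x = y) is left ex then sval (cid ex) else 1.
have fK : cancel f g.
  move=> x; rewrite /g; case: pselect => [ex|[]]; last by exists x.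
  by case: cid => x' /= /f_inj.
have gf : g \o f = id by apply: funext.
apply: (can_inj (g := @chain_map G F g n)) => z.
by rewrite chain_map_comp gf chain_map_id.
Qed.

(** Homology commutes with this direct limit: a cycle comes from some level, and
    it is a cycle there by injectivity. *)
Section TelescopeHomology.
Variables (F : groupType) (s : {multiplicative F -> F}) (s_inj : injective s).
Local Notation A := (telescope s_inj).
Local Notation lev := (@level F s s_inj).

Lemma level_seq (t : seq A) : exists k (u : seq F), map (lev k) u = t.
Proof.
elim: t => [|x t [k [u <-]]]; first by exists 0%N, [::].
rewrite -(level_repr x); move: (_.1) (_.2) => m v.
exists (k + m)%N, (iter k s v :: map (iter m s) u); rewrite /= -level_iter.
by rewrite -map_comp; congr (_ :: _); apply: eq_map => y /=; rewrite addnC -level_iter.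
Qed.

Lemma chain_map_level_iter k m n (z : bar_chain F n) :
  chain_map (lev k) z = chain_map (lev (m + k)) (chain_map (iter m s) z).
Proof.
rewrite chain_map_comp; congr (chain_map _ z); apply: funext => u /=.
exact: level_iter.
Qed.

Lemma chain_level n (z : bar_chain A n) : exists k z', chain_map (lev k) z' = z.
Proof.
elim/freeg_ind_sub: z => [t|a b [k [a' <-]] [m [b' <-]]|]; last first.
- by exists 0%N, 0%R; rewrite raddf0.
- rewrite (chain_map_level_iter k m) (chain_map_level_iter m k) addnC.
  by eexists; eexists; rewrite -raddfB.
have [k [u ut]] := level_seq t.
have su : size u == n by rewrite -(size_map (lev k)) ut size_tuple.
by exists k, << Tuple su >>; rewrite chain_mapU; congr << _ >>; apply: val_inj.
Qed.

Lemma telescope_acyclic :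
    (forall n (z : bar_chain F n.+2), bar_boundary z = 0%R ->
       exists c, bar_boundary c = z) ->
    (forall z : bar_chain F 1, exists c, bar_boundary c = chain_map s z) ->
  acyclic A.
Proof.
move=> H2F H1s n z; have [k [z' <-]] := chain_level z; case: n z' {z} => [|n] z dz.
  have [c dc] := H1s z; exists (chain_map (lev k.+1) c).
  rewrite -(chain_map_boundary (@levelM _ _ s_inj _)) dc.
  by rewrite (chain_map_level_iter k 1).
have [|c <-] := H2F n z; last first.
  by exists (chain_map (lev k) c); rewrite -(chain_map_boundary (@levelM _ _ s_inj _)).
apply: (@chain_map_inj _ _ _ _ (@level_inj _ _ s_inj k)).
by rewrite (chain_map_boundary (@levelM _ _ s_inj _)) dz [RHS]raddf0.
Qed.

End TelescopeHomology.

(** * The group attached to a family of commutator decompositions *)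

Lemma free_eval_mem (X : choiceType) (G : groupType) (f : X -> G) (K : set G) u :
  is_subgroup K -> (forall x, K (f x)) -> K (free_eval f u).
Proof.
move=> [K1 KM KV] Kf; elim/free_group_ind: u => // -[x b] u Ku.
rewrite free_evalM free_eval_letter; apply: KM Ku.
by case: b; [apply: KV|]; exact: Kf.
Qed.

Lemma free_group_higher_cycles (X : choiceType) n (z : bar_chain (free_group X) n.+2) :
  bar_boundary z = 0%R -> exists c, bar_boundary c = z.
Proof. exact: higher_cycles_bound (@fox_boundary X) (@fox_mul X) n z. Qed.

Lemma subst_null_homologous (N : choiceType) (child : N -> nat -> bool -> N)
    (k : N -> nat) (z : bar_chain (free_group N) 1) :
  exists c, bar_boundary c = chain_map (subst child k) z.
Proof.
elim/freeg_ind_sub: z => [t|a b|]; last 2 first.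
- by move=> [c dc] [d dd]; exists (c - d)%R; rewrite !raddfB /= dc dd.
- by exists 0%R; rewrite !raddf0.
have [u ->] : exists u, t = [tuple u].
  by exists (thead t); apply: eq_tuple_nth => -[|//] _; rewrite /thead (tnth_nth 1).
have [c dc] : null_homologous (subst child k u).
  apply: free_eval_mem; first exact: null_homologous_subgroup.
  have [one mul _] := null_homologous_subgroup (free_group N).
  move=> x; rewrite /subst_val; elim/big_ind: _ => // i _.
  exact: commg_null_homologous.
exists c; rewrite dc chain_mapU; congr << _ >>; exact: val_inj.
Qed.

Section Decomposition.
Variables (G : groupType) (U : choiceType) (v : U -> G).
Variables (k : U -> nat) (a : U -> nat -> bool -> U).
Hypothesis v_comm : forall x,
  v x = \prod_(i < (k x).+1) [~ v (a x i false), v (a x i true)].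

(** A node is a root with a path in the tree of decompositions.  Labels may
    repeat; it is the paths that make the children of distinct nodes distinct,
    hence [expand] injective. *)
Definition node := (U * seq (nat * bool))%type.

Definition node_label (y : node) : U := foldr (fun q x => a x q.1 q.2) y.1 y.2.

Definition node_child (y : node) i b : node := (y.1, (i, b) :: y.2).

Definition expand := @subst node node_child (fun y => k (node_label y)).

Lemma expand_inj : injective expand.
Proof. by apply: subst_inj => -[x p] i b [y q] j c [-> -> -> ->]. Qed.

HB.instance Definition _ := UMagmaMorphism.on expand.

Definition node_eval := free_eval (fun y : node => v (node_label y)).

HB.instance Definition _ := UMagmaMorphism.on node_eval.

Lemma node_eval_expand u : node_eval (expand u) = node_eval u.
Proof.
apply: (free_hom_eq (f := node_eval \o expand)) => [x y||y].
- by rewrite /comp !gmulfM.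
- exact: gmulfM.
rewrite /comp [expand _]free_eval_gen [RHS]free_eval_gen v_comm.
rewrite [LHS]gmulf_prod; apply: eq_bigr => i _.
rewrite [LHS]gmulfR; congr [~ _, _]; exact: free_eval_gen.
Qed.

Lemma acyclic_cover : exists (A : groupType) (phi : {multiplicative A -> G}),
  [/\ locally_free A, acyclic A & range v `<=` range phi].
Proof.
exists (telescope expand_inj), (tele_morphism expand_inj node_eval_expand); split.
- exact: telescope_locally_free.
- apply: telescope_acyclic; first exact: free_group_higher_cycles.
  exact: subst_null_homologous.
move=> _ [x _ <-]; exists (level expand_inj 0 (gen (x, [::]))) => //.
by rewrite [LHS](tele_map_level expand_inj node_eval_expand); exact: free_eval_gen.
Qed.

End Decomposition.

(** * Perfect subgroups *)

(** A union of subgroups rather than the subgroup that they generate: the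
    decompositions of an element stay inside a single perfect subgroup. *)
Definition perfect_part (G : groupType) : set G :=
  [set g | exists P : set G, [/\ is_subgroup P, perfect P & P g]].

Lemma perfect_part_commutators (G : groupType) g : perfect_part g ->
  exists s : seq (G * G),
    (forall q, q \in s -> perfect_part q.1 /\ perfect_part q.2) /\
    g = \prod_(q <- s) [~ q.1, q.2].
Proof.
move=> [P [sP perfP]]; rewrite perfP.
pose K := [set h | exists s : seq (G * G),
    (forall q, q \in s -> perfect_part q.1 /\ perfect_part q.2) /\
    h = \prod_(q <- s) [~ q.1, q.2]].
apply: (@generated_sub _ _ K) => [|_ [x Px [y Py <-]]]; last first.
  exists [:: (x, y)]; split; last by rewrite big_seq1.
  by move=> q /[!inE] /eqP->; split; exists P.
split.
- by exists [::]; rewrite big_nil.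
- move=> _ _ [s [sU ->]] [t [tU ->]]; exists (s ++ t); rewrite big_cat; split=> // q.
  by rewrite mem_cat => /orP[/sU|/tU].
- move=> _ [s [sU ->]]; exists (rev [seq (q.2, q.1) | q <- s]); split.
    by move=> q; rewrite mem_rev => /mapP[p /sU[p1 p2] ->].
  elim: s {sU} => [|q s IHs]; first by rewrite /= !big_nil invg1.
  by rewrite big_cons invgM IHs /= rev_cons -cats1 big_cat big_seq1 invgR.
Qed.

Theorem proposition2p3 (G : groupType) :
  exists (A : groupType) (phi : {multiplicative A -> G}),
    [/\ locally_free A, acyclic A &
        forall P : set G, is_subgroup P -> perfect P -> P `<=` range phi].
Proof.
pose U := {g : G | `[< perfect_part g >]}.
have comm_ex (x : U) : exists s : seq (U * U),
    val x = \prod_(q <- s) [~ val q.1, val q.2].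
  have [s [sU ->]] := perfect_part_commutators (asboolW (valP x)).
  elim: s sU => [|[g h] s IHs] sU; first by exists [::]; rewrite !big_nil.
  have [|t tE] := IHs; first by move=> q qs; apply: sU; rewrite inE qs orbT.
  have [/asboolT gU /asboolT hU] := sU _ (mem_head _ _).
  by exists ((exist _ g gU, exist _ h hU) :: t); rewrite !big_cons tE.
have [c cE] := choice comm_ex.
(* The trivial commutator [~ x, x] in front makes every decomposition
   nonempty, also that of 1: injectivity needs a first pair of children. *)
pose a (x : U) i b := let q := nth (x, x) ((x, x) :: c x) i in if b then q.2 else q.1.
have v_comm (x : U) :
    val x = \prod_(i < (size (c x)).+1) [~ val (a x i false), val (a x i true)].
  rewrite {1}cE -[LHS]mul1g -(commgg (val x)).
  rewrite -(big_cons _ _ (x, x) _ xpredT (fun q => [~ val q.1, val q.2])).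
  by rewrite (big_nth (x, x)) big_mkord.
have [A [phi [lfA acA phiU]]] := acyclic_cover v_comm.
exists A, phi; split=> // P sP perfP g Pg; apply: phiU.
have gU : `[< perfect_part g >] by apply/asboolP; exists P.
by exists (exist _ g gU : U).
Qed.
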